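(* Let $(\mathbf{x},\mathbf{y})\in\mathbb{R}_{>0}^{m+s}$ be an activity and let $\bar P=\{(\bar{\mathbf{x}},\bar{\mathbf{y}})\in P \mid \bar{\mathbf{x}}\ge \mathbf{x},\ \bar{\mathbf{y}}\le \mathbf{y}\}$. Let $\gamma(\mathbf{x},\mathbf{y})=\delta^*(\mathbf{x},\mathbf{y})\cdot\max\rho^*|_{\bar P}$ be the composite SBM score of $(\mathbf{x},\mathbf{y})$. Then: 1. $\gamma(\mathbf{x},\mathbf{y})=\rho^*(\mathbf{x},\mathbf{y})$ if $(\mathbf{x},\mathbf{y})$ is inefficient. 2. $\gamma(\mathbf{x},\mathbf{y})=\delta^*(\mathbf{x},\mathbf{y})$ if $(\mathbf{x},\mathbf{y})$ is efficient and $\max\rho^*|_{\bar P}=1$, i.e. there are efficient activities in $\bar P$. 3. $\max\rho^*|_{\bar P}<\gamma(\mathbf{x},\mathbf{y})<\delta^*(\mathbf{x},\mathbf{y})$ if $(\mathbf{x},\mathbf{y})$ is efficient and $\max\rho^*|_{\bar P}<1$, i.e. any activity in $\bar P$ is inefficient.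
   Context: Vector inequalities are componentwise; $\mathbb{R}_+=[0,\infty)$, $\mathbb{R}_{>0}=(0,\infty)$. An activity with $m$ inputs and $s$ outputs ($m,s\ge1$) is a pair $(\mathbf{x},\mathbf{y})\in\mathbb{R}_{>0}^{m+s}$ with $\mathbf{x}\in\mathbb{R}_{>0}^m$, $\mathbf{y}\in\mathbb{R}_{>0}^s$. Fix a set $\mathcal{D}$ of $n\ge 1$ reference DMUs, each identified with an activity $(\mathbf{x}_j,\mathbf{y}_j)\in\mathbb{R}_{>0}^{m+s}$, $j=1,\dots,n$; $X$ is the $m\times n$ matrix with columns $\mathbf{x}_j$ and $Y$ the $s\times n$ matrix with columns $\mathbf{y}_j$. The production possibility set is $P=\{(\mathbf{x},\mathbf{y})\in\mathbb{R}_{>0}^{m+s}\mid \mathbf{x}\ge X\boldsymbol{\lambda},\ \mathbf{y}\le Y\boldsymbol{\lambda}\text{ for some }\boldsymbol{\lambda}\in\mathbb{R}_+^n\}$. $(\mathbf{x},\mathbf{y})$ is dominated by $(\mathbf{x}',\mathbf{y}')$ if $\mathbf{x}'\le\mathbf{x}$ and $\mathbf{y}'\ge\mathbf{y}$; strictly dominated if moreover $(\mathbf{x}',\mathbf{y}')\ne(\mathbf{x},\mathbf{y})$. An activity (whether in $P$ or not) is efficient if it is not strictly dominated by any positive combination $(X\boldsymbol{\lambda},Y\boldsymbol{\lambda})$, $\boldsymbol{\lambda}\in\mathbb{R}_+^n$; otherwise it is inefficient. SBM efficiency score: for $(\mathbf{x},\mathbf{y})\in P$, $\rho^*(\mathbf{x},\mathbf{y})$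 is the minimum of $$\rho(\mathbf{x},\mathbf{y},\mathbf{s}^-,\mathbf{s}^+)=\frac{1-\frac1m\sum_{i=1}^m s_i^-/x_i}{1+\frac1s\sum_{r=1}^s s_r^+/y_r}$$ over $\boldsymbol{\lambda}\in\mathbb{R}_+^n$, $\mathbf{s}^-\in\mathbb{R}_+^m$, $\mathbf{s}^+\in\mathbb{R}_+^s$ subject to $\mathbf{x}=X\boldsymbol{\lambda}+\mathbf{s}^-$, $\mathbf{y}=Y\boldsymbol{\lambda}-\mathbf{s}^+$; for $(\mathbf{x},\mathbf{y})\notin P$, $\rho^*(\mathbf{x},\mathbf{y})=1$. SBM super-efficiency score: $\delta^*(\mathbf{x},\mathbf{y})$ is the minimum of $$\delta(\mathbf{x},\mathbf{y},\mathbf{t}^-,\mathbf{t}^+)=\frac{1+\frac1m\sum_{i=1}^m t_i^-/x_i}{1-\frac1s\sum_{r=1}^s t_r^+/y_r}$$ over $\boldsymbol{\lambda}\in\mathbb{R}_+^n$, $\mathbf{t}^-\in\mathbb{R}_+^m$, $\mathbf{t}^+\in\mathbb{R}_+^s$ subject to $\mathbf{x}+\mathbf{t}^-\ge X\boldsymbol{\lambda}$, $\mathbf{0}<\mathbf{y}-\mathbf{t}^+\le Y\boldsymbol{\lambda}$. $\max\rho^*|_{\bar P}$ denotes the maximum of $\rho^*$ over $\bar P$. *)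

(* Defs.v *)
From HB Require Import structures.
From mathcomp Require Import all_boot all_order all_algebra.
From mathcomp Require Import all_classical all_reals.

Set Implicit Arguments.
Unset Strict Implicit.
Unset Printing Implicit Defensive.

Import Order.TTheory GRing.Theory Num.Theory.
Local Open Scope classical_set_scope.
Local Open Scope ring_scope.

Definition lev {R : realType} {k : nat} (u v : 'cV[R]_k) : Prop :=
  forall i, u i 0 <= v i 0.

Definition ltv {R : realType} {k : nat} (u v : 'cV[R]_k) : Prop :=
  forall i, u i 0 < v i 0.

(* Least (greatest) element; the default value 0 is returned when there is
   none, so that [has_minimum] ([has_maximum]) has to be established before
   anything can be said about the value. *)
Definition is_minimum {R : realType} (S : set R) (v : R) : Prop :=
  S v /\ lbound S v.

Definition is_maximum {R : realType} (S : set R) (v : R) : Prop :=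
  S v /\ ubound S v.

Definition has_minimum {R : realType} (S : set R) : Prop :=
  exists v, is_minimum S v.

Definition has_maximum {R : realType} (S : set R) : Prop :=
  exists v, is_maximum S v.

Definition minimum {R : realType} (S : set R) : R := xget 0 (is_minimum S).

Definition maximum {R : realType} (S : set R) : R := xget 0 (is_maximum S).

Section SBM.
Context {R : realType} {m s n : nat}.
(* Columns of [X] and [Y] are the inputs and outputs of the reference DMUs. *)
Variables (X : 'M[R]_(m, n)) (Y : 'M[R]_(s, n)).

Implicit Types (p q : 'cV[R]_m * 'cV[R]_s) (l : 'cV[R]_n).

Definition activity p : Prop := ltv 0 p.1 /\ ltv 0 p.2.

Definition PPS : set ('cV[R]_m * 'cV[R]_s) :=
  [set p | activity p /\
    exists l, [/\ lev 0 l, lev (X *m l) p.1 & lev p.2 (Y *m l)]].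

(* [dominated p q]: [p] is dominated by [q]. *)
Definition dominated p q : Prop := lev q.1 p.1 /\ lev p.2 q.2.

Definition strictly_dominated p q : Prop := dominated p q /\ q <> p.

Definition efficient p : Prop :=
  ~ exists l, lev 0 l /\ strictly_dominated p (X *m l, Y *m l).

Definition inefficient p : Prop := ~ efficient p.

Definition rho p (sm : 'cV[R]_m) (sp : 'cV[R]_s) : R :=
  (1 - m%:R^-1 * \sum_(i < m) (sm i 0 / p.1 i 0)) /
  (1 + s%:R^-1 * \sum_(r < s) (sp r 0 / p.2 r 0)).

Definition rho_feasible p l (sm : 'cV[R]_m) (sp : 'cV[R]_s) : Prop :=
  [/\ lev 0 l, lev 0 sm, lev 0 sp,
      p.1 = X *m l + sm & p.2 = Y *m l - sp].

Definition rho_values p : set R :=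
  [set v | exists l sm sp, rho_feasible p l sm sp /\ v = rho p sm sp].

Definition rho_star p : R :=
  if `[< PPS p >] then minimum (rho_values p) else 1.

Definition delta p (tm : 'cV[R]_m) (tp : 'cV[R]_s) : R :=
  (1 + m%:R^-1 * \sum_(i < m) (tm i 0 / p.1 i 0)) /
  (1 - s%:R^-1 * \sum_(r < s) (tp r 0 / p.2 r 0)).

Definition delta_feasible p l (tm : 'cV[R]_m) (tp : 'cV[R]_s) : Prop :=
  [/\ lev 0 l, lev 0 tm & lev 0 tp] /\
  [/\ lev (X *m l) (p.1 + tm), ltv 0 (p.2 - tp) & lev (p.2 - tp) (Y *m l)].

Definition delta_values p : set R :=
  [set v | exists l tm tp, delta_feasible p l tm tp /\ v = delta p tm tp].

Definition delta_star p : R := minimum (delta_values p).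

Definition Pbar p : set ('cV[R]_m * 'cV[R]_s) :=
  [set q | [/\ PPS q, lev p.1 q.1 & lev q.2 p.2]].

Definition max_rho_star_Pbar p : R := maximum (rho_star @` Pbar p).

Definition gamma p : R := delta_star p * max_rho_star_Pbar p.

End SBM.

(* Main.v *)
Require Import Defs.
From mathcomp Require Import all_boot all_order all_algebra.
From mathcomp Require Import all_classical all_reals.
From mathcomp Require Import topology normedtype.
From mathcomp Require Import ring lra.

Set Implicit Arguments.
Unset Strict Implicit.
Unset Printing Implicit Defensive.

Import Order.TTheory GRing.Theory Num.Theory numFieldNormedType.Exports.
Local Open Scope classical_set_scope.
Local Open Scope ring_scope.

(** Once an intensity vector [l] is given, the best slacks are determined by it,
    and both scores become quotients of two means of coordinatewise ratios, written
    [mean_ratio u v] for the mean of the [u i / v i]. Thus [rho_star q] is the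
    least [mean_ratio (X l) q.1 / mean_ratio (Y l) q.2] over the [l] feasible
    for [q]. In this form one reads off that [rho_star] lies in (0, 1] on the
    production possibility set, equals 1 there exactly at the efficient
    activities ([rho_star_eq1]), and is monotone for domination
    ([rho_star_dominated]): the same [l] serves the dominated activity, with a
    smaller numerator and a larger denominator.

    For the fixed activity [(x, y)], let [clip l] be the pair of the
    coordinatewise maximum of [x] and [X l] and the coordinatewise minimum of
    [y] and [Y l]. For nonzero [l] it is an activity of [Pbar], and it
    dominates every activity of [Pbar] for which [l] is feasible, so [rho_star]
    has to be maximized along [clip] only; and the best slacks for [l] in the
    super-efficiency program lead from [(x, y)] to [clip l], so [delta_star] is
    the minimum over nonzero [l] of [mean_ratio (clip l).1 x / mean_ratio (clip
    l).2 y]. Consequently [delta_star] is 1 if [(x, y)] is in the production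
    possibility set and exceeds 1 otherwise. The three cases follow. An
    inefficient [(x, y)] lies in the set, so its [delta_star] is 1 and, by
    monotonicity, the maximum over [Pbar] is attained at [(x, y)] itself. The
    second case is immediate. If every activity of [Pbar] is inefficient while
    [(x, y)] is efficient, then [(x, y)] is outside the set, and the product of
    [delta_star > 1] with a maximum strictly between 0 and 1 lies strictly
    between its two factors.

    It remains to see that the extrema are attained. Rescaling a very small or
    a very large [l] moves [clip l] to an activity dominating it
    ([clip_slab]), so [l] may be confined to a compact set, and the function to
    be minimized for [delta_star] is continuous. The maximum of [rho_star] over
    [Pbar] is the delicate point, because [rho_star q] is a minimum over a set
    which varies with [q]: what is needed is upper semicontinuity
    ([rho_star_usc]), hence that an intensity vector feasible for [q] can be
    moved slightly to become feasible for a nearby activity. This is where the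
    polyhedral nature of the constraints is used, through the error bound of
    Hoffman ([hoffman]): a point violating a solvable system of linear
    inequalities by at most [e] is within a constant times [e] of a solution,
    the constant depending on the coefficients alone. *)

(** * Hoffman's error bound for linear inequalities *)

(** If [t0] violates an upper bound, the least upper bound [r i / c i] is a
    solution: it meets the lower bounds because each of them is compatible with
    each upper bound, and its distance to [t0] is the violation of that one
    constraint divided by [c i]. *)
Lemma clamp_below (R : realFieldType) (I : finType) (c r : I -> R) (t0 d : R) :
  0 <= d ->
  (forall i, c i = 0 -> 0 <= r i) ->
  (forall i k, 0 < c i -> c k < 0 -> c k * r i <= c i * r k) ->
  (forall i, c i * t0 <= r i + d) ->
  (exists2 i, 0 < c i & r i < c i * t0) ->
  exists t, (forall i, c i * t <= r i) /\
            `|t - t0| <= (\sum_i `|c i|^-1) * d.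
Proof.
move=> d0 r0 rr viol [i0 ci0 ri0].
case: (@Order.TotalTheory.arg_minP _ _ _ i0 (fun i => 0 < c i)
         (fun i => r i / c i) ci0) => i ci min_i.
have le_t0 : r i / c i <= t0.
  apply: le_trans (min_i _ ci0) _.
  by rewrite ler_pdivrMr // mulrC ltW.
exists (r i / c i); split=> [k|].
  case: (ltrgt0P (c k)) => ck.
  - by rewrite mulrC -ler_pdivlMr // min_i.
  - by rewrite mulrA ler_pdivrMr // [r k * _]mulrC rr.
  - by rewrite ck mul0r r0.
rewrite distrC ger0_norm ?subr_ge0 //.
apply: (@le_trans _ _ (`|c i|^-1 * d)).
  rewrite (gtr0_norm ci) lerBlDl [_^-1 * d]mulrC -mulrDl ler_pdivlMr //.
  by rewrite mulrC.
rewrite ler_wpM2r // (bigD1 i) //= lerDl sumr_ge0 // => k _.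
by rewrite invr_ge0.
Qed.

(** Clamping [t0] to the interval of solutions. The hypotheses on [r] express
    the solvability of the system as Fourier-Motzkin elimination does: one
    condition per constraint where [t] does not occur, and one per pair made of
    an upper and a lower bound. A violated lower bound becomes a violated upper
    bound when [c] and [t0] are negated. *)
Lemma hoffman_dim1 (R : realFieldType) (I : finType) (c r : I -> R) (t0 d : R) :
  0 <= d ->
  (forall i, c i = 0 -> 0 <= r i) ->
  (forall i k, 0 < c i -> c k < 0 -> c k * r i <= c i * r k) ->
  (forall i, c i * t0 <= r i + d) ->
  exists t, (forall i, c i * t <= r i) /\
            `|t - t0| <= (\sum_i `|c i|^-1) * d.
Proof.
move=> d0 r0 rr viol.
case: (boolP [exists i, r i < c i * t0]) => [/existsP[i ri]|]; last first.
  rewrite negb_exists => /forallP ok; exists t0; split=> [i|].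
    by rewrite leNgt.
  rewrite subrr normr0 mulr_ge0 // sumr_ge0 // => i _.
  by rewrite invr_ge0.
case: (ltrgt0P (c i)) => ci.
- by apply: clamp_below => //; exists i.
- case: (@clamp_below R I (fun i => - c i) r (- t0) d) => //.
  + by move=> k /eqP; rewrite oppr_eq0 => /eqP /r0.
  + move=> k l; rewrite oppr_gt0 oppr_lt0 => ck cl.
    by rewrite !mulNr lerN2 rr.
  + by move=> k; rewrite mulrNN.
  + by exists i; rewrite ?oppr_gt0 ?mulrNN.
  move=> t [tr tt0]; exists (- t); split=> [k|].
    by rewrite mulrN -mulNr tr.
  have -> : - t - t0 = - (t - - t0) by ring.
  by rewrite normrN; under eq_bigr => k _ do rewrite -normrN.
- by move: ri (r0 _ ci); rewrite ci mul0r => /lt_le_trans h /h; rewrite ltxx.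
Qed.

(** Hoffman's error bound, by Fourier-Motzkin elimination of the first unknown:
    the other unknowns are moved to a solution of the projected system, whose
    constraints are violated by a multiple of [e], and the first one is then
    clamped to the interval left for it. *)
Theorem hoffman (R : realFieldType) (n : nat) (I : finType)
    (A : I -> 'I_n -> R) :
  exists2 C, 0 <= C & forall (b : I -> R) (u0 : 'I_n -> R) (e : R),
    0 <= e -> (forall i, \sum_j A i j * u0 j <= b i + e) ->
    (exists u : 'I_n -> R, forall i, \sum_j A i j * u j <= b i) ->
    exists u : 'I_n -> R, (forall i, \sum_j A i j * u j <= b i) /\
      forall j, `|u j - u0 j| <= C * e.
Proof.
elim: n I A => [|n IHn] I A.
  by exists 0 => // b u0 e _ _ [u feas_u]; exists u; split=> // -[].
pose c i := A i ord0; pose a i j := A i (lift ord0 j).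
have split_sum i (u : 'I_n.+1 -> R) :
    \sum_j A i j * u j =
    c i * u ord0 + \sum_j a i j * u (lift ord0 j).
  by rewrite big_ord_recl.
(* The projected system is indexed by pairs of constraints: [(i, k)] stands for
   the combination of an upper bound [i] and a lower bound [k], for the
   constraint [i] itself if the eliminated unknown does not occur in it, and for
   the void constraint 0 <= 0 otherwise. *)
pose elim T (z : T) (f : I -> T) (g : I -> I -> T) p : T :=
  if c p.1 == 0 then f p.1
  else if (0 < c p.1) && (c p.2 < 0) then g p.1 p.2 else z.
pose A' p j := elim _ 0 (a^~ j) (fun i k => c i * a k j - c k * a i j) p.
have A'E p (v : 'I_n -> R) : \sum_j A' p j * v j =
    elim _ 0 (fun i => \sum_j a i j * v j)
      (fun i k => c i * (\sum_j a k j * v j) - c k * (\sum_j a i j * v j)) p.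
  rewrite /A' /elim; case: ifP => // _; case: ifP => _.
    rewrite !mulr_sumr -sumrB; apply: eq_bigr => j _; ring.
  by rewrite big1 // => j _; rewrite mul0r.
have [C' C'0 hC'] := IHn _ A'.
pose M := \sum_i `|c i|.
have leM i : `|c i| <= M.
  by rewrite /M (bigD1 i) //= lerDl sumr_ge0.
have M0 : 0 <= M by rewrite sumr_ge0.
pose S := \sum_i \sum_j `|a i j|.
have S0 : 0 <= S by rewrite sumr_ge0 // => i _; rewrite sumr_ge0.
(* The first unknown is exposed to the violation [e] and to the displacement of
   the other unknowns, which are at distance at most [C' * (1 + 2 * M) * e]. *)
pose K := 1 + S * (C' * (1 + 2 * M)).
pose N := \sum_i `|c i|^-1.
have N0 : 0 <= N by rewrite sumr_ge0 // => i _; rewrite invr_ge0.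
have C1 : 0 <= C' * (1 + 2 * M) by apply: mulr_ge0 => //; lra.
have K0 : 0 <= K by rewrite addr_ge0 // mulr_ge0.
exists (C' * (1 + 2 * M) + N * K) => [|b u0 e e0 viol [u feas_u]].
  by rewrite addr_ge0 // mulr_ge0.
pose b' := elim _ 0 b (fun i k => c i * b k - c k * b i).
have [|||v [feas_v dist_v]] :=
    hC' b' (fun j => u0 (lift ord0 j)) ((1 + 2 * M) * e).
- by apply: mulr_ge0 => //; lra.
- move=> p; rewrite A'E /b' /elim; case: eqP => [cp|_].
    move: (viol p.1); rewrite split_sum cp mul0r add0r => /le_trans; apply.
    by rewrite lerD2l mulrDl mul1r lerDl mulr_ge0 // mulr_ge0.
  case: ifP => [/andP[ci ck]|_]; last by rewrite add0r mulr_ge0 //; lra.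
  move: (viol p.1) (viol p.2) (leM p.1) (leM p.2); rewrite !split_sum.
  rewrite (gtr0_norm ci) (ltr0_norm ck).
  set x1 := \sum_j _; set x2 := \sum_j _ => v1 v2 l1 l2.
  have := ler_wpM2l (ltW ci) v2.
  have : - c p.2 * (c p.1 * u0 ord0 + x1) <= - c p.2 * (b p.1 + e).
    by rewrite ler_wpM2l // oppr_ge0 ltW.
  have : c p.1 * e <= M * e by rewrite ler_wpM2r.
  have : - c p.2 * e <= M * e by rewrite ler_wpM2r.
  by lra.
- exists (fun j => u (lift ord0 j)) => p; rewrite A'E /b' /elim.
  case: eqP => [cp|_].
    by move: (feas_u p.1); rewrite split_sum cp mul0r add0r.
  case: ifP => [/andP[ci ck]|_] //.
  move: (feas_u p.1) (feas_u p.2); rewrite !split_sum.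
  set x1 := \sum_j _; set x2 := \sum_j _ => v1 v2.
  have := ler_wpM2l (ltW ci) v2.
  have : - c p.2 * (c p.1 * u ord0 + x1) <= - c p.2 * b p.1.
    by rewrite ler_wpM2l // oppr_ge0 ltW.
  by lra.
pose r i := b i - \sum_j a i j * v j.
have [|||i|t [feas_t dist_t]] := @hoffman_dim1 R I c r (u0 ord0) (K * e).
- exact: mulr_ge0.
- move=> i ci; have := feas_v (i, i); rewrite A'E /b' /elim /= ci eqxx.
  by rewrite /r subr_ge0.
- move=> i k ci ck; have := feas_v (i, k).
  rewrite A'E /b' /elim /= gt_eqF // ci ck /= /r; lra.
- rewrite /r; have := viol i; rewrite split_sum.
  set x0 := \sum_j _; set x1 := \sum_j _ => vi.
  suff : x1 - x0 <= S * (C' * (1 + 2 * M) * e) by rewrite /K; lra.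
  rewrite /x1 /x0 -sumrB; apply: le_trans (ler_norm _) _.
  apply: le_trans (ler_norm_sum _ _ _) _.
  apply: (@le_trans _ _ (\sum_j `|a i j| * (C' * (1 + 2 * M) * e))).
    apply: ler_sum => j _; rewrite -mulrBr normrM ler_wpM2l //.
    by rewrite -mulrA dist_v.
  rewrite -mulr_suml ler_wpM2r //; first exact: mulr_ge0.
  rewrite /S (bigD1 i) //= lerDl sumr_ge0 // => k _.
  by rewrite sumr_ge0.
exists (fun j => if unlift ord0 j is Some k then v k else t); split=> [i|j].
  rewrite split_sum unlift_none; under eq_bigr do rewrite liftK.
  by have := feas_t i; rewrite /r; lra.
case: unliftP => [k ->|->].
  rewrite (le_trans (dist_v k)) // mulrA ler_wpM2r // lerDl.
  exact: mulr_ge0.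
rewrite (le_trans dist_t) // mulrA ler_wpM2r // lerDr; exact: C1.
Qed.

(** * Compactness, semicontinuity and limits *)

(** If there were no maximum, the sets of points of [K] where [f] is at least
    some [f p] would generate a filter on [K]. At a cluster point [p] of it, [f]
    is smaller near [p] than some [f p'] greater than [f p], which contradicts
    that [f p' <= f] holds on a member of the filter. *)
Lemma usc_attains_max (T : topologicalType) (R : realType) (K : set T)
    (f : T -> R) :
  compact K -> K !=set0 ->
  (forall p a, K p -> f p < a -> \forall t \near within K (nbhs p), f t < a) ->
  exists2 c, K c & forall t, K t -> f t <= f c.
Proof.
move=> compK [p0 Kp0] usc; apply: contrapT => nomax.
have higher p : K p -> exists2 p', K p' & f p < f p'.
  move=> Kp; apply: contrapT => nohigher; apply: nomax; exists p => // t Kt.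
  by rewrite leNgt; apply/negP => lt; apply: nohigher; exists t.
pose up p := [set t | K t /\ f p <= f t].
have properF : ProperFilter (filter_from K up).
  apply: filter_from_proper; last by move=> p Kp; exists p; split.
  apply: filter_from_filter; first by exists p0.
  move=> p q Kp Kq; case: (leP (f p) (f q)) => [pq|/ltW qp].
    by exists q => // t [Kt qt]; do 2 split=> //; exact: le_trans qt.
  by exists p => // t [Kt pt]; do 2 split=> //; exact: le_trans pt.
have [|p [Kp clust]] := compK _ properF; first by exists p0 => // t [].
have [p' Kp' lt_pp'] := higher p Kp.
have [|t [[Kt ge_t] /(_ Kt)]] := clust (up p') _ _ (usc _ _ Kp lt_pp').
  by exists p'.
by rewrite ltNge ge_t.
Qed.

Section Cvg.
Context {R : realType} {T : Type} {F : set_system T} {FF : Filter F}.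

Lemma cvg_sum_ord k (f : 'I_k -> T -> R) (l : 'I_k -> R) :
  (forall i, f i t @[t --> F] --> l i) ->
  \sum_(i < k) f i t @[t --> F] --> \sum_(i < k) l i.
Proof. by move=> fl; apply: cvg_big => //; exact: add_continuous. Qed.

Lemma cvg_mulmx_coord k n (A : 'M[R]_(k, n))
    (u : T -> 'cV[R]_n) (u0 : 'cV[R]_n) :
  (forall j, u t j 0 @[t --> F] --> u0 j 0) ->
  forall i, (A *m u t) i 0 @[t --> F] --> (A *m u0) i 0.
Proof.
move=> cu i; under eq_cvg do rewrite mxE; rewrite mxE.
by apply: cvg_sum_ord => j; apply: cvgM; [exact: cvg_cst|exact: cu].
Qed.

Lemma cvg_max (f g : T -> R) a b :
  f t @[t --> F] --> a -> g t @[t --> F] --> b ->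
  Num.max (f t) (g t) @[t --> F] --> Num.max a b.
Proof.
move=> fa gb; apply: continuous2_cvg fa gb.
exact: (@max_continuous _ R (a, b)).
Qed.

Lemma cvg_min (f g : T -> R) a b :
  f t @[t --> F] --> a -> g t @[t --> F] --> b ->
  Num.min (f t) (g t) @[t --> F] --> Num.min a b.
Proof.
move=> fa gb; apply: continuous2_cvg fa gb.
exact: (@min_continuous _ R (a, b)).
Qed.
End Cvg.

Lemma compact_cV_box (R : realType) n (a b : R) :
  compact [set l : 'cV[R]_n | forall j, a <= l j 0 <= b].
Proof.
have -> : [set l : 'cV[R]_n | forall j, a <= l j 0 <= b] =
    trmx @` [set v : 'rV[R]_n | forall j, `[a, b]%classic (v ord0 j)].
  apply/seteqP; split=> [l lab|_ [v vab <-] j] /=.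
    by exists l^T; rewrite ?trmxK // => j /=; rewrite mxE in_itv /= lab.
  by have := vab j; rewrite /= in_itv /= mxE.
apply: (@continuous_compact _ _ (@trmx R 1 n)); last first.
  apply: (@rV_compact R n (fun=> `[a, b]%classic)) => j.
  exact: segment_compact.
apply: continuous_subspaceT; move=> v U [P nP sPU].
exists (fun i j => P j i) => [i j|w Pw]; first by have := nP j i; rewrite mxE.
by apply: sPU => i j; rewrite mxE; exact: Pw.
Qed.

Lemma continuous_mulmx_coord (R : realType) k n (A : 'M[R]_(k, n)) i :
  continuous (fun l : 'cV[R]_n => (A *m l) i 0).
Proof.
move=> l; apply: (@cvg_mulmx_coord R _ (nbhs l) _ _ _ A id l) => j.
exact: coord_continuous.
Qed.

Lemma closed_mulmx_le (R : realType) k n (A : 'M[R]_(k, n)) i (c : R) :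
  closed [set l : 'cV[R]_n | (A *m l) i 0 <= c].
Proof.
have cA := @continuous_mulmx_coord R k n A i.
exact: (@preimage_closed _ _ _ [set t : R | t <= c] (in1W cA) (@closed_le R c)).
Qed.

Lemma closed_mulmx_ge (R : realType) k n (A : 'M[R]_(k, n)) i (c : R) :
  closed [set l : 'cV[R]_n | c <= (A *m l) i 0].
Proof.
have cA := @continuous_mulmx_coord R k n A i.
exact: (@preimage_closed _ _ _ [set t : R | c <= t] (in1W cA) (@closed_ge R c)).
Qed.

(** * Means of ratios and intensity vectors *)

Lemma ltv0P (R : realType) k (u : 'cV[R]_k) : ltv 0 u <-> forall i, 0 < u i 0.
Proof. by split=> u0 i; have := u0 i; rewrite mxE. Qed.

Lemma lev0P (R : realType) k (u : 'cV[R]_k) : lev 0 u <-> forall i, 0 <= u i 0.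
Proof. by split=> u0 i; have := u0 i; rewrite mxE. Qed.

Lemma ltvW (R : realType) k (u : 'cV[R]_k) : ltv 0 u -> lev 0 u.
Proof. by move=> u0 i; exact: ltW. Qed.

Lemma lev_neq_lt (R : realType) k (u v : 'cV[R]_k) :
  lev u v -> u <> v -> exists i, u i 0 < v i 0.
Proof.
move=> uv neq; apply: contrapT => nlt; apply: neq.
apply/matrixP => i j; rewrite ord1; apply/eqP; rewrite eq_le uv leNgt.
by apply/negP => lt; apply: nlt; exists i.
Qed.

Definition mean_ratio {R : realType} {k} (u v : 'cV[R]_k) : R :=
  k%:R^-1 * \sum_(i < k) (u i 0 / v i 0).

Lemma cvg_mean_ratio (R : realType) (T : Type) (F : set_system T)
    (FF : Filter F) k (u v : T -> 'cV[R]_k) (u0 v0 : 'cV[R]_k) :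
  (forall i, u t i 0 @[t --> F] --> u0 i 0) ->
  (forall i, v t i 0 @[t --> F] --> v0 i 0) -> ltv 0 v0 ->
  mean_ratio (u t) (v t) @[t --> F] --> mean_ratio u0 v0.
Proof.
move=> cu cv v0_gt0; apply: cvgM; first exact: cvg_cst.
apply: cvg_sum_ord => i; apply: cvgM; first exact: cu.
by apply: cvgV => //; have := v0_gt0 i; rewrite mxE => /gt_eqF ->.
Qed.

Section MeanRatio.
Context {R : realType} {k : nat} (k_gt0 : (0 < k)%N).
Implicit Types u v w : 'cV[R]_k.

Lemma mean_ratio_self v : ltv 0 v -> mean_ratio v v = 1.
Proof.
move=> /ltv0P v0; rewrite /mean_ratio (eq_bigr (fun=> 1)) => [|i _].
  by rewrite sumr_const card_ord mulVf // pnatr_eq0 -lt0n.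
by rewrite divff ?gt_eqF.
Qed.

Lemma mean_ratioD v w : ltv 0 v ->
  mean_ratio (v + w) v = 1 + k%:R^-1 * \sum_i (w i 0 / v i 0).
Proof.
move=> v0; rewrite /mean_ratio; under eq_bigr do rewrite mxE mulrDl.
by rewrite big_split /= mulrDr -/(mean_ratio v v) mean_ratio_self.
Qed.

Lemma mean_ratioB v w : ltv 0 v ->
  mean_ratio (v - w) v = 1 - k%:R^-1 * \sum_i (w i 0 / v i 0).
Proof.
move=> v0; rewrite mean_ratioD // -mulrN -sumrN.
by congr (_ + _ * _); apply: eq_bigr => i _; rewrite mxE mulNr.
Qed.

Lemma le_mean_ratio u u' v v' : lev 0 u -> lev u u' -> ltv 0 v' -> lev v' v ->
  mean_ratio u v <= mean_ratio u' v'.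
Proof.
move=> /lev0P u0 uu' /ltv0P v'0 vv'; rewrite ler_wpM2l ?invr_ge0 //.
apply: ler_sum => i _; have v0 := lt_le_trans (v'0 i) (vv' i).
by apply: ler_pM => //; rewrite ?invr_ge0 ?(ltW v0) ?lef_pV2 ?posrE.
Qed.

Lemma lt_mean_ratio u u' v : lev u u' -> u <> u' -> ltv 0 v ->
  mean_ratio u v < mean_ratio u' v.
Proof.
move=> uu' /(lev_neq_lt uu')[i lti] /ltv0P v0.
rewrite ltr_pM2l ?invr_gt0 ?ltr0n //.
rewrite (bigD1 i) //= [ltRHS](bigD1 i) //= ltr_leD ?ltr_pM2r ?invr_gt0 //.
by apply: ler_sum => j _; rewrite ler_pM2r ?invr_gt0.
Qed.

Lemma mean_ratio_gt0 u v : ltv 0 u -> ltv 0 v -> 0 < mean_ratio u v.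
Proof.
move=> /ltv0P u0 /ltv0P v0; rewrite mulr_gt0 ?invr_gt0 ?ltr0n //.
rewrite (bigD1 (Ordinal k_gt0)) //= ltr_pwDl ?divr_gt0 //.
by rewrite sumr_ge0 // => i _; rewrite divr_ge0 ?ltW.
Qed.

End MeanRatio.

Lemma le_mulmx (R : realType) k n (A : 'M[R]_(k, n)) (l l' : 'cV[R]_n) :
  (forall i j, 0 < A i j) -> lev l l' -> lev (A *m l) (A *m l').
Proof.
move=> A0 ll' i; rewrite !mxE; apply: ler_sum => j _.
by rewrite ler_wpM2l // ltW.
Qed.

Lemma mulmx_gt0 (R : realType) k n (A : 'M[R]_(k, n)) (l : 'cV[R]_n) :
  (forall i j, 0 < A i j) -> lev 0 l -> l <> 0 -> ltv 0 (A *m l).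
Proof.
move=> A0 l0 lN0; have [j ltj] : exists j, (0 : 'cV[R]_n) j 0 < l j 0.
  by apply: lev_neq_lt => // /esym.
apply/ltv0P => i; rewrite mxE (bigD1 j) //= ltr_pwDl //.
  by rewrite mulr_gt0 //; move: ltj; rewrite mxE.
by move/lev0P: l0 => l0; rewrite sumr_ge0 // => h _; rewrite mulr_ge0 // ltW.
Qed.

Lemma mulmx_le_sum (R : realType) k n (A : 'M[R]_(k, n)) (v : 'cV[R]_k)
    (l : 'cV[R]_n) e i :
  0 < e -> lev 0 l -> (forall j, A i j <= v i 0 / e) ->
  \sum_j l j 0 <= e -> 0 < v i 0 -> (A *m l) i 0 <= v i 0.
Proof.
move=> e0 /lev0P l0 Av suml v0.
apply: (@le_trans _ _ (\sum_j v i 0 / e * l j 0)).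
  by rewrite mxE; apply: ler_sum => j _; rewrite ler_wpM2r.
by rewrite -mulr_sumr -mulrA ler_piMr ?(ltW v0) // mulrC ler_pdivrMr // mul1r.
Qed.

Lemma mulmx_ge_sum (R : realType) k n (A : 'M[R]_(k, n)) (v : 'cV[R]_k)
    (l : 'cV[R]_n) e i :
  0 < e -> lev 0 l -> (forall j, v i 0 * e <= A i j) ->
  e^-1 <= \sum_j l j 0 -> 0 < v i 0 -> v i 0 <= (A *m l) i 0.
Proof.
move=> e0 /lev0P l0 Av suml v0.
apply: (@le_trans _ _ (\sum_j v i 0 * e * l j 0)); last first.
  by rewrite mxE; apply: ler_sum => j _; rewrite ler_wpM2r.
rewrite -mulr_sumr -mulrA ler_peMr ?(ltW v0) //.
by rewrite -ler_pdivrMl // mulr1.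
Qed.

Lemma pos_family_bounds (R : realType) (I : finType) (f : I -> R) :
  (forall i, 0 < f i) ->
  exists2 e, 0 < e & forall i, e <= f i <= e^-1.
Proof.
(* The leading 1 makes [S] positive for an empty family as well. *)
move=> f0; pose S := 1 + \sum_i (f i + (f i)^-1).
have fV0 i : 0 < (f i)^-1 by rewrite invr_gt0.
have S0 : 0 < S.
  by rewrite ltr_pwDl // sumr_ge0 // => i _; rewrite addr_ge0 // ltW.
have leS i : f i + (f i)^-1 <= S.
  rewrite /S (bigD1 i) //= addrCA lerDl addr_ge0 // sumr_ge0 // => k _.
  by rewrite addr_ge0 // ltW.
exists S^-1 => [|i]; first by rewrite invr_gt0.
rewrite invrK; apply/andP; split.
  rewrite -[leRHS]invrK lef_pV2 ?posrE //.
  by apply: le_trans (leS i); rewrite lerDr ltW.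
by apply: le_trans (leS i); rewrite lerDl ltW.
Qed.

Definition slab {R : realType} {n} (a b : R) : set 'cV[R]_n :=
  [set l | lev 0 l /\ a <= \sum_j l j 0 <= b].

Lemma slab_neq0 (R : realType) n (a b : R) (l : 'cV[R]_n) :
  0 < a -> slab a b l -> l <> 0.
Proof.
move=> a0 [_ /andP[al _]] l0; move: al; rewrite l0 big1 => [|j _].
  by rewrite leNgt a0.
by rewrite mxE.
Qed.

Lemma compact_slab (R : realType) n (a b : R) :
  compact (slab a b : set 'cV[R]_n).
Proof.
have sumE (l : 'cV[R]_n) :
    ((const_mx 1 : 'M[R]_(1, n)) *m l) 0 0 = \sum_j l j 0.
  by rewrite mxE; apply: eq_bigr => j _; rewrite mxE mul1r.
apply: (subclosed_compact _ (@compact_cV_box R n 0 b)).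
  have -> : slab a b =
      (\bigcap_j [set l : 'cV[R]_n | 0 <= ((1%:M : 'M[R]_n) *m l) j 0]) `&`
      [set l : 'cV[R]_n | a <= ((const_mx 1 : 'M[R]_(1, n)) *m l) 0 0] `&`
      [set l : 'cV[R]_n | ((const_mx 1 : 'M[R]_(1, n)) *m l) 0 0 <= b].
    apply/seteqP; split=> [l [/lev0P l0 /andP[al lb]]|l [[/= l0 al] lb]].
      split; last by rewrite /= sumE.
      by split=> [j _|]; rewrite /= ?mul1mx ?sumE.
    split; last by rewrite -sumE al.
    by apply/lev0P => i; have := l0 i I; rewrite /= mul1mx.
  apply: closedI; first apply: closedI.
  - by apply: closed_bigI => i _; exact: (@closed_mulmx_ge R n n 1%:M i 0).
  - exact: (@closed_mulmx_ge R 1 n (const_mx 1) 0 a).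
  - exact: (@closed_mulmx_le R 1 n (const_mx 1) 0 b).
move=> l [/lev0P l0 /andP[_ lb]] j /=; rewrite l0 /=; apply: le_trans lb.
by rewrite (bigD1 j) //= lerDl sumr_ge0.
Qed.

(** * The efficiency score *)

Lemma minimum_eq (R : realType) (S : set R) v :
  is_minimum S v -> minimum S = v.
Proof.
move=> minv; rewrite /minimum; case: xgetP => [w _ [Sw lew]|/(_ v)] //.
by case: minv => Sv lev; apply/eqP; rewrite eq_le lew // lev.
Qed.

Lemma maximum_eq (R : realType) (S : set R) v :
  is_maximum S v -> maximum S = v.
Proof.
move=> maxv; rewrite /maximum; case: xgetP => [w _ [Sw gew]|/(_ v)] //.
by case: maxv => Sv gev; apply/eqP; rewrite eq_le gev // gew.
Qed.

Definition feasible {R : realType} {m s n}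
    (X : 'M[R]_(m, n)) (Y : 'M[R]_(s, n))
    (l : 'cV[R]_n) (q : 'cV[R]_m * 'cV[R]_s) : Prop :=
  [/\ lev 0 l, lev (X *m l) q.1 & lev q.2 (Y *m l)].

(** The objective [rho] once the slacks are eliminated. *)
Definition score {R : realType} {m s n}
    (X : 'M[R]_(m, n)) (Y : 'M[R]_(s, n))
    (l : 'cV[R]_n) (q : 'cV[R]_m * 'cV[R]_s) : R :=
  mean_ratio (X *m l) q.1 / mean_ratio (Y *m l) q.2.

(** Moving a vector feasible for [q] to one feasible for a nearby [q']: with the
    coefficients [X], [Y] fixed, an activity is a right-hand side of the linear
    system defining feasibility. *)
Lemma feasible_hoffman (R : realType) m s n
    (X : 'M[R]_(m, n)) (Y : 'M[R]_(s, n)) :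
  exists2 C : R, 0 <= C &
    forall (q q' : 'cV[R]_m * 'cV[R]_s) (mu : 'cV[R]_n) (e : R), 0 <= e ->
    (forall i, `|q'.1 i 0 - q.1 i 0| <= e) ->
    (forall r, `|q'.2 r 0 - q.2 r 0| <= e) ->
    feasible X Y mu q -> (exists l, feasible X Y l q') ->
    exists mu', feasible X Y mu' q' /\ forall j, `|mu' j 0 - mu j 0| <= C * e.
Proof.
pose A (i : 'I_n + ('I_m + 'I_s)) (j : 'I_n) : R := match i with
  | inl i => - (i == j)%:R | inr (inl i) => X i j | inr (inr r) => - Y r j end.
pose b (q : 'cV[R]_m * 'cV[R]_s) (i : 'I_n + ('I_m + 'I_s)) : R := match i with
  | inl i => 0 | inr (inl i) => q.1 i 0 | inr (inr r) => - q.2 r 0 end.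
have AE (l : 'cV[R]_n) i : \sum_j A i j * l j 0 = match i with
    | inl i => - l i 0 | inr (inl i) => (X *m l) i 0
    | inr (inr r) => - (Y *m l) r 0 end.
  case: i => [i|[i|r]] /=; rewrite ?mxE // ?sumrN.
    rewrite (bigD1 i) //= eqxx mulN1r big1 ?addr0 // => j /negbTE ji.
    by rewrite eq_sym ji oppr0 mul0r.
  by rewrite -sumrN; apply: eq_bigr => j _; rewrite mulNr.
have feasP l q : feasible X Y l q <-> forall i, \sum_j A i j * l j 0 <= b q i.
  split=> [[/lev0P l0 lX lY] i|h].
    by rewrite AE; case: i => [i|[i|r]] /=; rewrite ?oppr_le0 ?lerN2.
  by split=> i;
    [have := h (inl i)|have := h (inr (inl i))|have := h (inr (inr i))];
    rewrite AE /= ?mxE ?oppr_le0 ?lerN2.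
have [C C0 hC] := hoffman A.
exists C => // q q' mu e e0 q1 q2 /feasP feas_mu [l /feasP feas_l].
have [||u [feas_u dist_u]] := hC (b q') (fun j => mu j 0) _ e0.
- move=> i; apply: le_trans (feas_mu i) _.
  case: i => [i|[i|r]] /=; first by rewrite add0r.
    by have := q1 i; rewrite ler_norml; lra.
  by have := q2 r; rewrite ler_norml; lra.
- by exists (fun j => l j 0).
exists (\col_j u j); split=> [|j]; last by rewrite mxE.
apply/feasP => i; apply: le_trans (feas_u i).
by under eq_bigr do rewrite mxE.
Qed.

Section Scores.
Context {R : realType} {m s n : nat}.
Hypotheses (m_gt0 : (0 < m)%N) (s_gt0 : (0 < s)%N).
Variables (X : 'M[R]_(m, n)) (Y : 'M[R]_(s, n)).
Hypotheses (X_gt0 : forall i j, 0 < X i j) (Y_gt0 : forall r j, 0 < Y r j).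
Implicit Types (q : 'cV[R]_m * 'cV[R]_s) (l : 'cV[R]_n).

Lemma PPSP q : PPS X Y q <-> activity q /\ exists l, feasible X Y l q.
Proof. by []. Qed.

Lemma feasible_neq0 q l : activity q -> feasible X Y l q -> l <> 0.
Proof.
move=> [_ /ltv0P q2] [_ _ ly] l0; have := ly (Ordinal s_gt0).
by rewrite l0 mulmx0 mxE leNgt q2.
Qed.

Lemma feasible_gt0 q l : activity q -> feasible X Y l q ->
  ltv 0 (X *m l) /\ ltv 0 (Y *m l).
Proof.
move=> aq fl; have lN0 := feasible_neq0 aq fl; case: fl => l0 _ _.
by split; exact: mulmx_gt0.
Qed.

Lemma mean_ratio_output_ge1 q l : activity q -> feasible X Y l q ->
  1 <= mean_ratio (Y *m l) q.2.
Proof.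
move=> [_ q2] [_ _ ly]; rewrite -(mean_ratio_self s_gt0 q2).
by apply: le_mean_ratio => // i; have /ltv0P/(_ i)/ltW := q2; rewrite mxE.
Qed.

Lemma score_gt0 q l : activity q -> feasible X Y l q -> 0 < score X Y l q.
Proof.
move=> aq fl; have [Xl0 Yl0] := feasible_gt0 aq fl; case: (aq) => q1 q2.
by rewrite divr_gt0 // mean_ratio_gt0.
Qed.

Lemma score_le1 q l : activity q -> feasible X Y l q -> score X Y l q <= 1.
Proof.
move=> aq fl; have Y1 := mean_ratio_output_ge1 aq fl.
have [/ltvW Xl0 _] := feasible_gt0 aq fl; case: (aq) (fl) => q1 q2 [_ lx _].
rewrite ler_pdivrMr ?(lt_le_trans ltr01) // mul1r (le_trans _ Y1) //.
by rewrite -(mean_ratio_self m_gt0 q1) le_mean_ratio.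
Qed.

Lemma score_lt1 q l : activity q -> feasible X Y l q ->
  (X *m l, Y *m l) <> q -> score X Y l q < 1.
Proof.
case: q => x y aq fl neq; have Y1 := mean_ratio_output_ge1 aq fl.
have [/ltvW Xl0 _] := feasible_gt0 aq fl; case: (aq) (fl) => q1 q2 [_ lx ly].
rewrite ltr_pdivrMr ?(lt_le_trans ltr01) // mul1r.
have [eqx|/(lt_mean_ratio m_gt0 lx)/(_ q1)] := pselect (X *m l = x).
  have neqy : y <> Y *m l by move=> eqy; apply: neq; rewrite eqx -eqy.
  rewrite /= eqx (mean_ratio_self m_gt0 q1) -(mean_ratio_self s_gt0 q2).
  exact: lt_mean_ratio.
by rewrite (mean_ratio_self m_gt0 q1) => /lt_le_trans; apply.
Qed.

(** A vector feasible for the dominating activity is feasible for the dominated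
    one, whose larger inputs and smaller outputs decrease the numerator and
    increase the denominator. *)
Lemma score_dominated q q' l : activity q -> activity q' -> dominated q q' ->
  feasible X Y l q' -> feasible X Y l q /\ score X Y l q <= score X Y l q'.
Proof.
move=> aq aq' [dx dy] fl; have [/ltvW Xl0 Yl0] := feasible_gt0 aq' fl.
case: (aq) (aq') (fl) => q1 q2 [q1' q2'] [l0 lx ly]; split.
  split=> // i; first exact: le_trans (lx i) (dx i).
  exact: le_trans (dy i) (ly i).
apply: ler_pM.
- rewrite mulr_ge0 ?invr_ge0 // sumr_ge0 // => i _.
  by rewrite divr_ge0 // ?(ltW (proj1 (ltv0P _) q1 i)) // (proj1 (lev0P _) Xl0).
- by rewrite invr_ge0 ltW // mean_ratio_gt0.
- exact: le_mean_ratio.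
- rewrite lef_pV2 ?posrE ?mean_ratio_gt0 //.
  by apply: le_mean_ratio => //; exact: ltvW.
Qed.

(** The slacks are [q.1 - X l] and [Y l - q.2], which turns the numerator of
    [rho] into [mean_ratio (X l) q.1] and its denominator into
    [mean_ratio (Y l) q.2]. *)
Lemma rho_valuesP q : activity q ->
  rho_values X Y q = [set score X Y l q | l in feasible X Y ^~ q].
Proof.
move=> [q1 q2]; apply/seteqP; split.
  move=> _ [l [sm [sp [[l0 sm0 sp0 eqx eqy] ->]]]].
  exists l; first split=> // i.
  - by rewrite eqx [leRHS]mxE lerDl; have := sm0 i; rewrite mxE.
  - by rewrite eqy [leLHS]mxE [X in _ + X]mxE gerBl; have := sp0 i; rewrite mxE.
  rewrite /score /rho -(mean_ratioD s_gt0 sp q2) -(mean_ratioB m_gt0 sm q1).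
  have -> : q.1 - sm = X *m l by rewrite eqx addrK.
  by have -> : q.2 + sp = Y *m l by rewrite eqy subrK.
move=> _ [l [l0 lx ly] <-].
exists l, (q.1 - X *m l), (Y *m l - q.2); split.
  split=> //.
  - by move=> i; rewrite !mxE subr_ge0; have := lx i; rewrite mxE.
  - by move=> i; rewrite !mxE subr_ge0; have := ly i; rewrite mxE.
  - by rewrite addrC subrK.
  - by rewrite opprB addrC subrK.
rewrite /score /rho -(mean_ratioD s_gt0 _ q2) -(mean_ratioB m_gt0 _ q1).
by rewrite opprB ![_ + (_ - _)]addrC !subrK.
Qed.

Lemma compact_feasible q : compact [set l : 'cV[R]_n | feasible X Y l q].
Proof.
pose i0 := Ordinal m_gt0.
pose B := q.1 i0 0 * \sum_j (X i0 j)^-1.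
apply: (subclosed_compact _ (@compact_cV_box R n 0 B)).
  have -> : [set l : 'cV[R]_n | feasible X Y l q] =
      (\bigcap_j [set l : 'cV[R]_n | 0 <= ((1%:M : 'M[R]_n) *m l) j 0]) `&`
      (\bigcap_i [set l : 'cV[R]_n | (X *m l) i 0 <= q.1 i 0]) `&`
      (\bigcap_r [set l : 'cV[R]_n | q.2 r 0 <= (Y *m l) r 0]).
    apply/seteqP; split=> [l [/lev0P l0 lx ly]|l [[l0 lx] ly]].
      split; last by move=> r _; exact: ly.
      by split=> i _; [rewrite /= mul1mx|exact: lx].
    split; [apply/lev0P|..] => i; [|exact: lx|exact: ly].
    by have := l0 i I; rewrite /= mul1mx.
  apply: closedI; first apply: closedI; apply: closed_bigI => i _.
  - exact: (@closed_mulmx_ge R n n 1%:M i 0).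
  - exact: (@closed_mulmx_le R m n X i (q.1 i 0)).
  - exact: (@closed_mulmx_ge R s n Y i (q.2 i 0)).
move=> l [/lev0P l0 lx _] j /=; rewrite l0 /=.
have Xl : X i0 j * l j 0 <= q.1 i0 0.
  apply: le_trans (lx i0); rewrite mxE (bigD1 j) //= lerDl sumr_ge0 // => h _.
  by rewrite mulr_ge0 // ltW.
have q0 : 0 <= q.1 i0 0 by apply: le_trans Xl; rewrite mulr_ge0 // ltW.
apply: (@le_trans _ _ (q.1 i0 0 * (X i0 j)^-1)).
  by rewrite ler_pdivlMr // mulrC.
rewrite ler_wpM2l // (bigD1 j) //= lerDl sumr_ge0 // => h _.
by rewrite invr_ge0 ltW.
Qed.

Lemma cvg_score {T : Type} {F : set_system T} {FF : Filter F}
    (l : T -> 'cV[R]_n) (q : T -> 'cV[R]_m * 'cV[R]_s) l0 q0 :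
  activity q0 -> feasible X Y l0 q0 ->
  (forall j, l t j 0 @[t --> F] --> l0 j 0) ->
  (forall i, (q t).1 i 0 @[t --> F] --> q0.1 i 0) ->
  (forall r, (q t).2 r 0 @[t --> F] --> q0.2 r 0) ->
  score X Y (l t) (q t) @[t --> F] --> score X Y l0 q0.
Proof.
move=> aq fl cl c1 c2; have Y1 := mean_ratio_output_ge1 aq fl.
case: (aq) => q1 q2.
apply: cvgM; first by apply: cvg_mean_ratio => //; exact: cvg_mulmx_coord.
apply: cvgV; first by rewrite gt_eqF // (lt_le_trans ltr01).
by apply: cvg_mean_ratio => //; exact: cvg_mulmx_coord.
Qed.

Lemma rho_has_minimum q : PPS X Y q -> has_minimum (rho_values X Y q).
Proof.
move=> /PPSP[aq [l fl]]; rewrite rho_valuesP //.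
pose K := [set l : 'cV[R]_n | feasible X Y l q].
case: (@usc_attains_max _ _ K (fun l => - score X Y l q)).
- exact: compact_feasible.
- by exists l.
- move=> p a fp; apply: (@cvgr_lt _ _ (within K (nbhs p))); apply: cvgN.
  apply: (@cvg_score _ (within K (nbhs p)) _ id (fun=> q)) => // i.
  + apply: cvg_trans (@coord_continuous _ _ _ i 0 p).
    by apply: cvg_app; exact: cvg_within.
  + exact: cvg_cst.
  + exact: cvg_cst.
move=> c fc cmin; exists (score X Y c q); split; first by exists c.
by move=> _ [t ft <-]; rewrite -lerN2 cmin.
Qed.

Lemma rho_starP q : PPS X Y q ->
  exists2 l, feasible X Y l q & rho_star X Y q = score X Y l q.
Proof.
move=> Pq; rewrite /rho_star; case: asboolP => // _.
have [v minv] := rho_has_minimum Pq; rewrite (minimum_eq minv).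
case: Pq minv => aq _ []; rewrite rho_valuesP // => -[l fl <-] _.
by exists l.
Qed.

Lemma rho_star_le q l : activity q -> feasible X Y l q ->
  rho_star X Y q <= score X Y l q.
Proof.
move=> aq fl; have Pq : PPS X Y q by apply/PPSP; split=> //; exists l.
rewrite /rho_star; case: asboolP => // _.
have [v minv] := rho_has_minimum Pq; rewrite (minimum_eq minv).
by case: minv => _; apply; rewrite rho_valuesP //; exists l.
Qed.

Lemma rho_star_gt0 q : PPS X Y q -> 0 < rho_star X Y q.
Proof.
move=> Pq; have [l fl ->] := rho_starP Pq.
by case: Pq => aq _; exact: score_gt0.
Qed.

Lemma rho_star_le1 q : PPS X Y q -> rho_star X Y q <= 1.
Proof.
move=> Pq; have [l fl ->] := rho_starP Pq.
by case: Pq => aq _; exact: score_le1.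
Qed.

Lemma rho_star_eq1 q : PPS X Y q -> rho_star X Y q = 1 <-> efficient X Y q.
Proof.
move=> Pq; case: (Pq) => aq _; split=> [r1 [l [l0 [[lx ly] neq]]]|eff].
  have fl : feasible X Y l q by [].
  by have := le_lt_trans (rho_star_le aq fl) (score_lt1 aq fl neq);
    rewrite r1 ltxx.
have [l fl ->] := rho_starP Pq.
have eql : (X *m l, Y *m l) = q.
  apply: contrapT => neq; apply: eff; exists l.
  by case: fl => l0 lx ly; split.
have [eqx eqy] : X *m l = q.1 /\ Y *m l = q.2 by rewrite -eql.
by case: aq => q1 q2; rewrite /score eqx eqy !mean_ratio_self ?divr1.
Qed.

Lemma rho_star_dominated q q' : activity q -> PPS X Y q' -> dominated q q' ->
  PPS X Y q /\ rho_star X Y q <= rho_star X Y q'.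
Proof.
move=> aq Pq' dom; have [l fl ->] := rho_starP Pq'; case: (Pq') => aq' _.
have [fl' le] := score_dominated aq aq' dom fl.
split; first by apply/PPSP; split=> //; exists l.
exact: le_trans (rho_star_le _ _) le.
Qed.

(** Let [mu0] be optimal for [q0]. Hoffman's bound provides vectors [mu t]
    feasible for [q t] that tend to [mu0] as [q t] tends to [q0]; their scores
    bound [rho_star] from above and tend to that of [mu0]. *)
Lemma rho_star_usc {T : Type} {F : set_system T} {FF : Filter F}
    (q : T -> 'cV[R]_m * 'cV[R]_s) q0 a :
  (\forall t \near F, PPS X Y (q t)) -> PPS X Y q0 ->
  (forall i, (q t).1 i 0 @[t --> F] --> q0.1 i 0) ->
  (forall r, (q t).2 r 0 @[t --> F] --> q0.2 r 0) ->
  rho_star X Y q0 < a -> \forall t \near F, rho_star X Y (q t) < a.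
Proof.
move=> Pq Pq0 c1 c2; have [mu0 fmu0 ->] := rho_starP Pq0 => lta.
have [C C0 hC] := feasible_hoffman X Y.
pose e t := \sum_i `|(q t).1 i 0 - q0.1 i 0| + \sum_r `|(q t).2 r 0 - q0.2 r 0|.
have e_ge0 t : 0 <= e t by rewrite addr_ge0 ?sumr_ge0.
have /choice[mu mu_spec] : forall t, exists mu, PPS X Y (q t) ->
    feasible X Y mu (q t) /\ forall j, `|mu j 0 - mu0 j 0| <= C * e t.
  move=> t; have [Pt|nPt] := pselect (PPS X Y (q t)); last by exists 0.
  case: (Pt) => _ ex.
  have [||mu' hmu'] := hC q0 (q t) mu0 (e t) (e_ge0 t) _ _ fmu0 ex.
  - move=> i; rewrite /e (bigD1 i) //= -addrA lerDl.
    by rewrite addr_ge0 ?sumr_ge0.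
  - move=> r; rewrite /e [X in _ <= _ + X](bigD1 r) //= addrCA lerDl.
    by rewrite addr_ge0 ?sumr_ge0.
  by exists mu'.
have e_cvg0 : C * e t @[t --> F] --> (0 : R).
  have sum0 k (f : T -> 'cV[R]_k) (f0 : 'cV[R]_k) :
      (forall i, f t i 0 @[t --> F] --> f0 i 0) ->
      \sum_i `|f t i 0 - f0 i 0| @[t --> F] --> (0 : R).
    move=> cf; have sumz : \sum_(i < k) (0 : R) = 0 by rewrite big1.
    rewrite -[X in _ --> X]sumz.
    apply: cvg_sum_ord => i; rewrite -(normr0 R) -(subrr (f0 i 0)).
    by apply: cvg_norm; apply: cvgB; [exact: cf|exact: cvg_cst].
  rewrite -(mulr0 C); apply: cvgM; first exact: cvg_cst.
  by rewrite -(addr0 0); apply: cvgD; [exact: (sum0 _ (fst \o q))|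
                                      exact: (sum0 _ (snd \o q))].
have mu_cvg j : mu t j 0 @[t --> F] --> mu0 j 0.
  apply/cvgrPdist_lt => eps eps0.
  have e_lt := @cvgr_lt _ _ F FF _ _ e_cvg0 eps eps0.
  near=> t; rewrite distrC.
  have [_ dist] : feasible X Y (mu t) (q t) /\
      forall j, `|mu t j 0 - mu0 j 0| <= C * e t.
    by apply: mu_spec; near: t.
  by apply: le_lt_trans (dist j) _; near: t.
case: (Pq0) => aq0 _.
have sc_cvg := cvg_score (FF := FF) aq0 fmu0 mu_cvg c1 c2.
have sc_lt := @cvgr_lt _ _ F FF _ _ sc_cvg _ lta.
near=> t.
have Pt : PPS X Y (q t) by near: t.
have [fmu _] := mu_spec t Pt.
apply: le_lt_trans (rho_star_le _ fmu) _; first by case: Pt.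
by near: t.
Unshelve. all: by end_near.
Qed.
(** * The best activity produced by an intensity vector *)

Section Composite.
Hypothesis n_gt0 : (0 < n)%N.
Variables (x : 'cV[R]_m) (y : 'cV[R]_s).
Hypothesis xy_activity : activity (x, y).

Let x_gt0 : ltv 0 x. Proof. by case: xy_activity. Qed.
Let y_gt0 : ltv 0 y. Proof. by case: xy_activity. Qed.

Let x_pos i : 0 < x i 0. Proof. exact: (proj1 (ltv0P _) x_gt0). Qed.
Let y_pos r : 0 < y r 0. Proof. exact: (proj1 (ltv0P _) y_gt0). Qed.

(** The activity closest to [(x, y)] among those of [Pbar] for which [l] is
    feasible. *)
Definition clip l : 'cV[R]_m * 'cV[R]_s :=
  (\col_i Num.max (x i 0) ((X *m l) i 0),
   \col_r Num.min (y r 0) ((Y *m l) r 0)).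

Lemma clip_feasible l : lev 0 l -> feasible X Y l (clip l).
Proof.
move=> l0; split=> // i; first by rewrite [leRHS]mxE le_max lexx orbT.
by rewrite [leLHS]mxE ge_min lexx orbT.
Qed.

Lemma clip_between l : lev x (clip l).1 /\ lev (clip l).2 y.
Proof. by split=> i; rewrite mxE ?le_max ?ge_min lexx. Qed.

Lemma clip_Pbar l : lev 0 l -> l <> 0 -> Pbar X Y (x, y) (clip l).
Proof.
move=> l0 lN0; have [clx cly] := clip_between l.
split=> //; apply/PPSP; split; last by exists l; exact: clip_feasible.
have /ltv0P Yl0 := mulmx_gt0 Y_gt0 l0 lN0.
split; apply/ltv0P => i; first exact: lt_le_trans (x_pos i) (clx i).
by rewrite mxE lt_min Yl0 y_pos.
Qed.

(** [clip l] has the least inputs above [x] and [X l], and the greatest outputs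
    below [y] and [Y l]. *)
Lemma dominated_clip q l : Pbar X Y (x, y) q -> feasible X Y l q ->
  dominated q (clip l).
Proof.
move=> [_ xq qy] [_ lx ly].
by split=> i; rewrite mxE ?ge_max ?le_min ?xq ?lx ?qy ?ly.
Qed.

Lemma dominated_refl q : dominated q q.
Proof. by split=> i. Qed.

(** If the entries of [l] add up to less than [e], then [X l <= x] and
    [Y l <= y], so scaling [l] up to total [e] increases the outputs of [clip l]
    while its inputs stay equal to [x]. If they add up to more than [e^-1], then
    [x <= X l] and [y <= Y l], and scaling down decreases the inputs while the
    outputs stay equal to [y]. *)
Lemma clip_slab : exists a b, 0 < a /\ forall l, lev 0 l -> l <> 0 ->
  exists2 l', slab a b l' & dominated (clip l) (clip l').
Proof.
pose f (i : 'I_m * 'I_n + 'I_s * 'I_n) := match i with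
  | inl p => x p.1 0 / X p.1 p.2 | inr p => y p.1 0 / Y p.1 p.2 end.
have f0 i : 0 < f i.
  by case: i => p; rewrite divr_gt0.
have [e e0 ef] := pos_family_bounds f0.
have [eX Xe] : (forall i j, X i j <= x i 0 / e) /\
    (forall i j, x i 0 * e <= X i j).
  split=> i j; have /andP[] := ef (inl (i, j)); rewrite /= => h1 h2.
    by rewrite ler_pdivlMr // mulrC -ler_pdivlMr.
  by rewrite -ler_pdivlMr // mulrC -ler_pdivrMr.
have [eY Ye] : (forall i j, Y i j <= y i 0 / e) /\
    (forall i j, y i 0 * e <= Y i j).
  split=> i j; have /andP[] := ef (inr (i, j)); rewrite /= => h1 h2.
    by rewrite ler_pdivlMr // mulrC -ler_pdivlMr.
  by rewrite -ler_pdivlMr // mulrC -ler_pdivrMr.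
have e_le : e <= e^-1.
  by have /andP[] := ef (inl (Ordinal m_gt0, Ordinal n_gt0)); exact: le_trans.
exists e, e^-1; split=> // l l0 lN0.
pose S := \sum_j l j 0.
have l_ge0 := proj1 (lev0P _) l0.
have S0 : 0 < S.
  have [j] : exists j, (0 : 'cV[R]_n) j 0 < l j 0.
    by apply: lev_neq_lt => // /esym.
  rewrite mxE => lj.
  by rewrite /S (bigD1 j) //= ltr_pwDl // sumr_ge0.
have scale0 c : 0 < c -> lev 0 (c *: l).
  by move=> c0; apply/lev0P => j; rewrite mxE mulr_ge0 // ltW.
have sum_scale c : \sum_j (c / S *: l) j 0 = c.
  rewrite (eq_bigr (fun j => c / S * l j 0)) => [|j _]; last by rewrite mxE.
  by rewrite -mulr_sumr -/S divfK ?gt_eqF.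
have scale_le c : c <= 1 -> lev (c *: l) l.
  by move=> c1 j; rewrite mxE ler_piMl.
have scale_ge c : 1 <= c -> lev l (c *: l).
  by move=> c1 j; rewrite mxE ler_peMl.
have [Se|eS] := ltP S e.
  exists (e / S *: l).
    by split; [apply: scale0; rewrite divr_gt0|rewrite sum_scale lexx].
  split=> i; rewrite [leLHS]mxE [leRHS]mxE.
    rewrite ge_max le_max lexx /= le_max.
    rewrite (@mulmx_le_sum _ _ _ X x _ e) ?sum_scale //.
    by apply: scale0; rewrite divr_gt0.
  rewrite le_min ge_min lexx /= ge_min; apply/orP; right.
  by apply: le_mulmx => //; apply: scale_ge; rewrite ler_pdivlMr ?mul1r ?ltW.
have [Se|eS'] := leP S e^-1.
  by exists l; [split; rewrite // -/S eS Se|exact: dominated_refl].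
have eV0 : 0 < e^-1 by rewrite invr_gt0.
exists (e^-1 / S *: l).
  by split; [apply: scale0; rewrite divr_gt0|rewrite sum_scale lexx e_le].
split=> i; rewrite [leLHS]mxE [leRHS]mxE.
  rewrite ge_max le_max lexx /= le_max; apply/orP; right.
  by apply: le_mulmx => //; apply: scale_le; rewrite ler_pdivrMr ?mul1r ?ltW.
rewrite le_min ge_min lexx /= ge_min.
rewrite (@mulmx_ge_sum _ _ _ Y y _ e) ?sum_scale //.
by apply: scale0; rewrite divr_gt0.
Qed.

Lemma clip_cvg (p : 'cV[R]_n) (K : set 'cV[R]_n) :
  (forall i, (clip l).1 i 0 @[l --> within K (nbhs p)] --> (clip p).1 i 0) /\
  (forall r, (clip l).2 r 0 @[l --> within K (nbhs p)] --> (clip p).2 r 0).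
Proof.
have coord j : (l : 'cV[R]_n) j 0 @[l --> within K (nbhs p)] --> p j 0.
  apply: cvg_trans (@coord_continuous _ _ _ j 0 p).
  by apply: cvg_app; exact: cvg_within.
split=> i; rewrite mxE; under eq_cvg do rewrite mxE.
  apply: cvg_max; first exact: cvg_cst.
  exact: (@cvg_mulmx_coord _ _ (within K (nbhs p)) _ _ _ X id).
apply: cvg_min; first exact: cvg_cst.
exact: (@cvg_mulmx_coord _ _ (within K (nbhs p)) _ _ _ Y id).
Qed.

Lemma slab_inhabited a b : (forall l, lev 0 l -> l <> 0 ->
    exists2 l', slab a b l' & dominated (clip l) (clip l')) ->
  (slab a b : set 'cV[R]_n) !=set0.
Proof.
move=> inslab; have [||l' ? _] := inslab (const_mx 1); last by exists l'.
  by apply/lev0P => j; rewrite mxE.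
move/matrixP/(_ (Ordinal n_gt0) 0)/eqP; rewrite !mxE oner_eq0.
by [].
Qed.

(** * The super-efficiency score *)

(** The value of [delta] at the slacks leading from [(x, y)] to [clip l], the
    smallest ones with which [l] is feasible. *)
Definition clip_delta l : R :=
  mean_ratio (clip l).1 x / mean_ratio (clip l).2 y.

Lemma clip_gt0 l : lev 0 l -> l <> 0 -> ltv 0 (clip l).1 /\ ltv 0 (clip l).2.
Proof. by move=> l0 lN0; have [[]] := clip_Pbar l0 lN0. Qed.

Lemma deltaE tm tp : delta (x, y) tm tp =
  mean_ratio (x + tm) x / mean_ratio (y - tp) y.
Proof.
by rewrite /delta (mean_ratioD m_gt0 _ x_gt0) (mean_ratioB s_gt0 _ y_gt0).
Qed.

Lemma clip_delta_value l : lev 0 l -> l <> 0 ->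
  delta_values X Y (x, y) (clip_delta l).
Proof.
move=> l0 lN0; have [cx cy] := clip_between l.
have [_ fx fy] := clip_feasible l0; have [_ cy0] := clip_gt0 l0 lN0.
have eqx : x + ((clip l).1 - x) = (clip l).1 by rewrite addrC subrK.
have eqy : y - (y - (clip l).2) = (clip l).2 by rewrite opprB addrC subrK.
exists l, ((clip l).1 - x), (y - (clip l).2).
rewrite deltaE eqx eqy; split=> //; rewrite /delta_feasible /= eqx eqy.
by split; split=> //; apply/lev0P => i; rewrite [leRHS]mxE [X in _ + X]mxE
  subr_ge0.
Qed.

Lemma clip_delta_le_value v : delta_values X Y (x, y) v ->
  exists2 l, lev 0 l /\ l <> 0 & clip_delta l <= v.
Proof.
move=> [l [tm [tp [[[l0 tm0 tp0] [/= lx ty0 ly]] ->]]]].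
have lN0 : l <> 0.
  move=> l_eq0; have := lt_le_trans (ty0 (Ordinal s_gt0)) (ly (Ordinal s_gt0)).
  by rewrite l_eq0 mulmx0 mxE ltxx.
exists l => //; rewrite deltaE /clip_delta.
have [c1 c2] := clip_gt0 l0 lN0.
have le1 : lev (clip l).1 (x + tm).
  move=> i; rewrite [leLHS]mxE ge_max lx andbT [leRHS]mxE lerDl.
  exact: (proj1 (lev0P _) tm0).
have le2 : lev (y - tp) (clip l).2.
  move=> i; rewrite [leRHS]mxE le_min ly andbT [leLHS]mxE [X in _ + X]mxE gerBl.
  exact: (proj1 (lev0P _) tp0).
apply: ler_pM.
- by rewrite ltW // mean_ratio_gt0.
- by rewrite invr_ge0 ltW // mean_ratio_gt0.
- by apply: le_mean_ratio => //; exact: ltvW.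
- rewrite lef_pV2 ?posrE ?mean_ratio_gt0 //.
  by apply: le_mean_ratio => //; exact: ltvW.
Qed.

Lemma clip_delta_dominated l l' : lev 0 l -> l <> 0 -> lev 0 l' -> l' <> 0 ->
  dominated (clip l) (clip l') -> clip_delta l' <= clip_delta l.
Proof.
move=> l0 lN0 l0' lN0' [d1 d2].
have [c1 c2] := clip_gt0 l0 lN0; have [c1' c2'] := clip_gt0 l0' lN0'.
apply: ler_pM.
- by rewrite ltW // mean_ratio_gt0.
- by rewrite invr_ge0 ltW // mean_ratio_gt0.
- by apply: le_mean_ratio => //; exact: ltvW.
- rewrite lef_pV2 ?posrE ?mean_ratio_gt0 //.
  by apply: le_mean_ratio => //; exact: ltvW.
Qed.

Lemma delta_minimizer : exists2 l, lev 0 l /\ l <> 0 &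
  is_minimum (delta_values X Y (x, y)) (clip_delta l).
Proof.
have [a [b [a0 inslab]]] := clip_slab.
case: (@usc_attains_max _ _ (slab a b) (fun l => - clip_delta l)).
- exact: compact_slab.
- exact: slab_inhabited.
- move=> p c Kp; have [c1 c2] := clip_cvg p (slab a b).
  have [cp1 cp2] : ltv 0 (clip p).1 /\ ltv 0 (clip p).2.
    by case: (Kp) => p0 _; exact: clip_gt0 (slab_neq0 a0 Kp).
  apply: (@cvgr_lt _ _ (within (slab a b) (nbhs p))); apply: cvgN.
  apply: cvgM; first by apply: cvg_mean_ratio => // i; exact: cvg_cst.
  apply: cvgV; first by rewrite gt_eqF // mean_ratio_gt0.
  by apply: cvg_mean_ratio => // i; exact: cvg_cst.
move=> l Kl lmin; have lN0 := slab_neq0 a0 Kl; case: (Kl) => l0 _.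
exists l => //; split; first exact: clip_delta_value.
move=> v /clip_delta_le_value[l1 [l10 l1N0]]; apply: le_trans.
have [l2 Kl2 dom] := inslab _ l10 l1N0; case: (Kl2) => l20 _.
apply: le_trans (clip_delta_dominated l10 l1N0 l20 (slab_neq0 a0 Kl2) dom).
by rewrite -lerN2 lmin.
Qed.

Lemma delta_starP : exists2 l, lev 0 l /\ l <> 0 &
  delta_star X Y (x, y) = clip_delta l.
Proof.
by have [l l0N0 /minimum_eq eq] := delta_minimizer; exists l.
Qed.

(** The value 1 would force [clip l] to be [(x, y)], which would then be
    produced by [l]. *)
Lemma clip_delta_gt1 l : lev 0 l -> l <> 0 -> ~ PPS X Y (x, y) ->
  1 < clip_delta l.
Proof.
move=> l0 lN0 nP; have [cx cy] := clip_between l.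
have [c1 c2] := clip_gt0 l0 lN0.
have le1 : 1 <= mean_ratio (clip l).1 x.
  rewrite -(mean_ratio_self m_gt0 x_gt0).
  by apply: le_mean_ratio => //; exact: ltvW.
have le2 : mean_ratio (clip l).2 y <= 1.
  rewrite -(mean_ratio_self s_gt0 y_gt0).
  by apply: le_mean_ratio => //; exact: ltvW.
rewrite ltr_pdivlMr ?mean_ratio_gt0 // mul1r.
have [eqx|neqx] := pselect (x = (clip l).1); last first.
  apply: le_lt_trans le2 _; rewrite -(mean_ratio_self m_gt0 x_gt0).
  exact: lt_mean_ratio.
have neqy : (clip l).2 <> y.
  move=> eqy; apply: nP; have [] := clip_Pbar l0 lN0.
  by rewrite [clip l]surjective_pairing -eqx eqy.
apply: lt_le_trans le1; rewrite -(mean_ratio_self s_gt0 y_gt0).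
exact: lt_mean_ratio.
Qed.

Lemma delta_star_gt1 : ~ PPS X Y (x, y) -> 1 < delta_star X Y (x, y).
Proof.
by move=> nP; have [l [l0 lN0] ->] := delta_starP; exact: clip_delta_gt1.
Qed.

(** The value 1 is attained without slacks, and no slacks bring [delta]
    below 1. *)
Lemma delta_star_eq1 : PPS X Y (x, y) -> delta_star X Y (x, y) = 1.
Proof.
move=> /PPSP[_ [l fl]]; apply: minimum_eq; split.
  exists l, 0, 0; rewrite deltaE addr0 subr0 !mean_ratio_self // divr1.
  case: fl => l0 lx ly.
  by split=> //; split; split=> //=; rewrite ?addr0 ?subr0.
move=> _ [l' [tm [tp [[[_ tm0 tp0] [_ ty0 _]] ->]]]]; rewrite deltaE.
have le1 : 1 <= mean_ratio (x + tm) x.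
  rewrite -(mean_ratio_self m_gt0 x_gt0); apply: le_mean_ratio => //.
    exact: ltvW.
  by move=> i; rewrite [leRHS]mxE lerDl (proj1 (lev0P _) tm0).
have le2 : mean_ratio (y - tp) y <= 1.
  rewrite -(mean_ratio_self s_gt0 y_gt0); apply: le_mean_ratio => //.
    exact: ltvW.
  by move=> i; rewrite [leLHS]mxE [X in _ + X]mxE gerBl (proj1 (lev0P _) tp0).
by rewrite ler_pdivlMr ?mean_ratio_gt0 // mul1r (le_trans le2).
Qed.

(** * The maximum of the efficiency score *)

(** Every activity of [Pbar] is dominated by some [clip l] with [l] in a fixed
    slab, on which the upper semicontinuous function [rho_star \o clip] attains
    its maximum. *)
Lemma rho_Pbar_has_maximum : has_maximum (rho_star X Y @` Pbar X Y (x, y)).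
Proof.
have [a [b [a0 inslab]]] := clip_slab.
case: (@usc_attains_max _ _ (slab a b) (fun l => rho_star X Y (clip l))).
- exact: compact_slab.
- exact: slab_inhabited.
- move=> p c Kp; have [c1 c2] := clip_cvg p (slab a b).
  have PPSclip l : slab a b l -> PPS X Y (clip l).
    by move=> Kl; case: (Kl) => l0 _; have [] := clip_Pbar l0 (slab_neq0 a0 Kl).
  apply: rho_star_usc => //; last exact: PPSclip.
  by apply: filterS (withinT _ _) => l /PPSclip.
move=> l Kl lmax; exists (rho_star X Y (clip l)); split.
  exists (clip l) => //; case: (Kl) => l0 _.
  exact: clip_Pbar (slab_neq0 a0 Kl).
move=> _ [q Pbq <-]; case: (Pbq) => /PPSP[aq [l1 fl1]] _ _.
have lN0 := feasible_neq0 aq fl1.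
have l10 : lev 0 l1 by case: fl1.
have [l2 Kl2 dom2] := inslab _ l10 lN0.
apply: le_trans (lmax _ Kl2).
have [Pclip1 _ _] := clip_Pbar l10 lN0.
have [Pclip2 _ _] : Pbar X Y (x, y) (clip l2).
  by case: (Kl2) => l20 _; exact: clip_Pbar (slab_neq0 a0 Kl2).
have [_ le1] := rho_star_dominated aq Pclip1 (dominated_clip Pbq fl1).
apply: le_trans le1 _.
by case: (Pclip1) => ac1 _; have [] := rho_star_dominated ac1 Pclip2 dom2.
Qed.

Lemma max_rho_starP : exists2 q, Pbar X Y (x, y) q &
  max_rho_star_Pbar X Y (x, y) = rho_star X Y q /\
  forall q', Pbar X Y (x, y) q' -> rho_star X Y q' <= rho_star X Y q.
Proof.
have [v maxv] := rho_Pbar_has_maximum.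
rewrite /max_rho_star_Pbar (maximum_eq maxv); case: maxv => -[q Pq <-] ub.
by exists q => //; split=> // q' Pq'; apply: ub; exists q'.
Qed.

Lemma inefficient_PPS : inefficient X Y (x, y) -> PPS X Y (x, y).
Proof.
by move=> /contrapT[l [l0 [[lx ly] _]]]; apply/PPSP; split=> //; exists l.
Qed.

Lemma PPS_Pbar : PPS X Y (x, y) -> Pbar X Y (x, y) (x, y).
Proof. by move=> P; split=> // i. Qed.

Lemma max_rho_star_eq1 : max_rho_star_Pbar X Y (x, y) = 1 <->
  exists q, Pbar X Y (x, y) q /\ efficient X Y q.
Proof.
have [q Pq [-> qmax]] := max_rho_starP; have Pq' : PPS X Y q by case: Pq.
split=> [/(rho_star_eq1 Pq') eff|[q' [Pbq' eff]]]; first by exists q.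
apply/eqP; rewrite eq_le rho_star_le1 //=; apply: le_trans (qmax _ Pbq').
by case: Pbq' => /rho_star_eq1[_ ->].
Qed.

Lemma max_rho_star_bounds : 0 < max_rho_star_Pbar X Y (x, y) <= 1.
Proof.
have [q [Pq _ _] [-> _]] := max_rho_starP.
by rewrite rho_star_gt0 // rho_star_le1.
Qed.

Lemma max_rho_star_lt1 : max_rho_star_Pbar X Y (x, y) < 1 <->
  forall q, Pbar X Y (x, y) q -> inefficient X Y q.
Proof.
have /andP[_ le1] := max_rho_star_bounds; rewrite lt_neqAle le1 andbT.
split=> [/eqP neq1 q Pq eff|ineff].
  by apply: neq1; apply/max_rho_star_eq1; exists q.
by apply/eqP => /max_rho_star_eq1[q [/ineff]].
Qed.

Lemma max_rho_star_PPS : PPS X Y (x, y) ->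
  max_rho_star_Pbar X Y (x, y) = rho_star X Y (x, y).
Proof.
move=> P; have [q Pq [-> qmax]] := max_rho_starP.
apply/eqP; rewrite eq_le qmax ?andbT; last exact: PPS_Pbar.
by case: Pq => -[aq _] qx qy; have [] := @rho_star_dominated q (x, y) aq P.
Qed.

End Composite.
End Scores.

(** * The composite score *)

Theorem proposition5p1 (R : realType) (m s n : nat)
    (m_gt0 : (0 < m)%N) (s_gt0 : (0 < s)%N) (n_gt0 : (0 < n)%N)
    (X : 'M[R]_(m, n)) (Y : 'M[R]_(s, n))
    (X_gt0 : forall i j, 0 < X i j) (Y_gt0 : forall r j, 0 < Y r j)
    (x : 'cV[R]_m) (y : 'cV[R]_s) (xy_activity : activity (x, y)) :
  (* the extrema defining the scores are attained *)
  [/\ forall q, PPS X Y q -> has_minimum (rho_values X Y q),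
      has_minimum (delta_values X Y (x, y)) &
      has_maximum (rho_star X Y @` Pbar X Y (x, y))] /\
  (* the two reformulations of the conditions on the maximum *)
  ((max_rho_star_Pbar X Y (x, y) = 1 <->
      exists q, Pbar X Y (x, y) q /\ efficient X Y q) /\
   (max_rho_star_Pbar X Y (x, y) < 1 <->
      forall q, Pbar X Y (x, y) q -> inefficient X Y q)) /\
  [/\ inefficient X Y (x, y) ->
        gamma X Y (x, y) = rho_star X Y (x, y),
      efficient X Y (x, y) -> max_rho_star_Pbar X Y (x, y) = 1 ->
        gamma X Y (x, y) = delta_star X Y (x, y) &
      efficient X Y (x, y) -> max_rho_star_Pbar X Y (x, y) < 1 ->
        max_rho_star_Pbar X Y (x, y) < gamma X Y (x, y) <
          delta_star X Y (x, y)].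
Proof.
split; first split.
- by move=> q; exact: rho_has_minimum.
- have [l _ minl] := delta_minimizer m_gt0 s_gt0 X_gt0 Y_gt0 n_gt0 xy_activity.
  by exists (clip_delta X Y x y l).
- exact: rho_Pbar_has_maximum.
split; first by split; [exact: max_rho_star_eq1|exact: max_rho_star_lt1].
rewrite /gamma; split=> [ineff|_ ->|eff max_lt1]; last 2 first.
- by rewrite mulr1.
- have nP : ~ PPS X Y (x, y).
    move=> P; have : inefficient X Y (x, y).
      have [lt1_ineff _] :=
        max_rho_star_lt1 m_gt0 s_gt0 X_gt0 Y_gt0 n_gt0 xy_activity.
      exact/lt1_ineff/PPS_Pbar.
    exact.
  have delta_gt1 :=
    delta_star_gt1 m_gt0 s_gt0 X_gt0 Y_gt0 n_gt0 xy_activity nP.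
  have /andP[max_gt0 _] :=
    max_rho_star_bounds m_gt0 s_gt0 X_gt0 Y_gt0 n_gt0 xy_activity.
  by rewrite ltr_pMl // delta_gt1 gtr_pMr // (lt_trans ltr01).
have P := inefficient_PPS xy_activity ineff.
by rewrite delta_star_eq1 // mul1r max_rho_star_PPS.
Qed.
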